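(* Let $\mathbb F$ be a field and let $N\ge 2$ be an integer. The map $B\mapsto\hat B$, sending a Billiard Array $B$ over $\mathbb F$ of diameter $N$ to its value function, induces a bijection between the following two sets: (i) the isomorphism classes of Billiard Arrays over $\mathbb F$ that have diameter $N$; (ii) the value functions on $\Delta_{N-2}$.
   Context: $\mathbb N=\{0,1,2,\ldots\}$. For $n\in\mathbb N$, $\Delta_n=\{(r,s,t): r,s,t\in\mathbb N,\ r+s+t=n\}$, whose elements are called locations. A line in $\Delta_N$ is a set consisting of all locations whose $\eta$-coordinate equals a fixed number $m$, for some $\eta\in\{1,2,3\}$ and some $0\le m\le N$. Locations $\lambda,\mu$ are adjacent if $\lambda-\mu$ is one of $\pm(1,-1,0),\pm(0,1,-1),\pm(-1,0,1)$. A black 3-clique in $\Delta_N$ is a set $\{(r+1,s,t),(r,s+1,t),(r,s,t+1)\}$ with $(r,s,t)\in\Delta_{N-1}$. Each pair of adjacent locations is contained in a unique black 3-clique. For a vector space $V$ over $\mathbb F$ of dimension $N+1$ let $\mathcal P_1(V)$ be the set of one-dimensional subspaces of $V$. A Billiard Array on $V$ is a function $B:\Delta_N\to\mathcal P_1(V)$, $\lambda\mapsto B_\lambda$, such that (i) for each line $L$ in $\Delta_N$ the sum $\sum_{\lambda\in L}B_\lambda$ is direct; (ii) for each black 3-clique $C$ in $\Delta_N$ the sum $\sum_{\lambda\in C}B_\lambda$ is not direct. Such a $B$ is said to be over $\mathbb F$ and to have diameter $N$. Billiard Arrays $B$ on $V$ and $B'$ on $V'$ (both of diameter $N$ over $\mathbb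 F$) are isomorphic if there is an $\mathbb F$-linear bijection $\sigma:V\to V'$ with $\sigma(B_\lambda)=B'_\lambda$ for all $\lambda\in\Delta_N$. For adjacent $\lambda,\mu\in\Delta_N$, let $\nu$ be the unique location such that $\lambda,\mu,\nu$ form a black 3-clique. For each nonzero $u\in B_\lambda$ there is a unique nonzero $v\in B_\mu$ with $u+v\in B_\nu$; the $\mathbb F$-linear bijection $\tilde B_{\lambda,\mu}:B_\lambda\to B_\mu$ sends $u\mapsto v$. A value function on $\Delta_n$ is a function $\Delta_n\to\mathbb F\setminus\{0\}$. The value function $\hat B:\Delta_{N-2}\to\mathbb F\setminus\{0\}$ of $B$ is defined as follows: for $(r,s,t)\in\Delta_{N-2}$ put $\lambda=(r,s+1,t+1)$, $\mu=(r+1,s,t+1)$, $\nu=(r+1,s+1,t)$ (these form a white 3-clique); the composition $\tilde B_{\nu,\lambda}\circ\tilde B_{\mu,\nu}\circ\tilde B_{\lambda,\mu}:B_\lambda\to B_\lambda$ is a nonzero scalar multiple of the identity, and $\hat B(r,s,t)$ is that scalar. *)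

(* Defs.v *)
From HB Require Import structures.
From mathcomp Require Import all_boot all_algebra.
From mathcomp Require Import zify.
From mathcomp Require Import boolp classical_sets.

Set Implicit Arguments.
Unset Strict Implicit.
Unset Printing Implicit Defensive.

Import GRing.Theory.
Local Open Scope ring_scope.

Record location (n : nat) := Location {
  loc_val :> nat * nat * nat;
  locP : (loc_val.1.1 + loc_val.1.2 + loc_val.2)%N == n
}.

HB.instance Definition _ n := [isSub for @loc_val n].
HB.instance Definition _ n := [Countable of location n by <:].

Lemma loc_bounds n (l : location n) :
  [&& (l.1.1 < n.+1)%N, (l.1.2 < n.+1)%N & (l.2 < n.+1)%N].
Proof.
by case: l => [[[r s] t] /= /eqP<-]; rewrite !ltnS leq_addl -addnA leq_addr
  addnCA leq_addr.
Qed.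

Definition loc_ord n (l : location n) : 'I_n.+1 * 'I_n.+1 * 'I_n.+1 :=
  (inord l.1.1, inord l.1.2, inord l.2).
Definition ord_loc n (x : 'I_n.+1 * 'I_n.+1 * 'I_n.+1) : option (location n) :=
  insub (x.1.1 : nat, x.1.2 : nat, x.2 : nat).

Lemma loc_ordK n : pcancel (@loc_ord n) (@ord_loc n).
Proof.
move=> l; have /and3P[h1 h2 h3] := loc_bounds l.
rewrite /ord_loc /= !inordK //; apply/eqP.
by case: l {h1 h2 h3} => [[[r s] t] h] /=; rewrite insubT.
Qed.

HB.instance Definition _ n :=
  isFinite.Build (location n) (pcan_enumP (@loc_ordK n)).

Definition coord n (eta : 'I_3) (l : location n) : nat :=
  nth 0%N [:: l.1.1; l.1.2; l.2] eta.

Definition is_line N (L : {set location N}) : Prop :=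
  exists (eta : 'I_3) (m : nat),
    (m <= N)%N /\ L = [set l | coord eta l == m]%SET.

(* Here (r, s, t) ranges over the locations of diameter N - 1; there is none
   when N = 0. *)
Definition is_black_clique N (C : {set location N}) : Prop :=
  exists r s t : nat, (r + s + t).+1 = N /\
    C = [set l : location N |
          loc_val l \in [:: (r.+1, s, t); (r, s.+1, t); (r, s, t.+1)]]%SET.

Record billiard_array (F : fieldType) (N : nat) := BilliardArray {
  ba_space : vectType F;
  ba_fun :> location N -> {vspace ba_space};
  ba_dim_space : \dim {: ba_space} = N.+1;
  ba_dim1 : forall l, \dim (ba_fun l) = 1%N;
  ba_line : forall L : {set location N}, is_line L ->
    directv (\sum_(l in L) ba_fun l);
  ba_black : forall C : {set location N}, is_black_clique C ->
    ~~ directv (\sum_(l in C) ba_fun l)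
}.

Definition isomorphic F N (B B' : billiard_array F N) : Prop :=
  exists sigma : 'Hom(ba_space B, ba_space B'),
    bijective sigma /\ forall l, (sigma @: B l)%VS = B' l.

(* An isomorphism class, as the set of all arrays isomorphic to a given one. *)
Definition iso_class F N : Type :=
  {C : billiard_array F N -> Prop | exists B, C = isomorphic B}.

Definition class_of F N (B : billiard_array F N) : iso_class F N :=
  exist _ (isomorphic B) (ex_intro _ B erefl).

(* The location completing two adjacent locations to a black 3-clique; the
   default value of xget is never used then, see third_eq. *)
Definition third N (la mu : location N) : location N :=
  xget la (fun nu => is_black_clique [set la; mu; nu]%SET).

(* The map from B_la to B_mu for adjacent la and mu: a nonzero u is sent to the
   nonzero v of B_mu such that u + v lies in B_nu, see btilde_unique. For u = 0
   there is no such v, and the default value of xget makes the map send 0 to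
   0. *)
Definition btilde F N (B : billiard_array F N) (la mu : location N)
    (u : ba_space B) : ba_space B :=
  xget 0 (fun v => [/\ v \in B mu, v != 0 & u + v \in B (third la mu)]).

Arguments btilde {F N} B la mu u.

Definition value_function (F : fieldType) (n : nat) : Type :=
  location n -> {c : F | c != 0}.

Section WhiteClique.
Variables (N : nat) (hN : (2 <= N)%N) (p : location (N - 2)).

Fact white1_subproof : (p.1.1 + p.1.2.+1 + p.2.+1)%N == N.
Proof. by rewrite !(addnS, addSn) (eqP (locP p)) -addn2 subnK. Qed.
Fact white2_subproof : (p.1.1.+1 + p.1.2 + p.2.+1)%N == N.
Proof. by rewrite !(addnS, addSn) (eqP (locP p)) -addn2 subnK. Qed.
Fact white3_subproof : (p.1.1.+1 + p.1.2.+1 + p.2)%N == N.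
Proof. by rewrite !(addnS, addSn) (eqP (locP p)) -addn2 subnK. Qed.

Definition white1 : location N :=
  @Location N (p.1.1, p.1.2.+1, p.2.+1) white1_subproof.
Definition white2 : location N :=
  @Location N (p.1.1.+1, p.1.2, p.2.+1) white2_subproof.
Definition white3 : location N :=
  @Location N (p.1.1.+1, p.1.2.+1, p.2) white3_subproof.
End WhiteClique.

(* The default value 1 of xget is never used, see bhatP. *)
Definition bhat F N (hN : (2 <= N)%N) (B : billiard_array F N) :
    value_function F (N - 2) :=
  fun p =>
    let la := white1 hN p in let mu := white2 hN p in let nu := white3 hN p in
    xget (exist _ 1 (oner_neq0 F)) (fun c => forall u, u \in B la ->
      btilde B nu la (btilde B mu nu (btilde B la mu u)) = val c *: u).

Lemma black_clique_coords N (a b c : location N) :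
  is_black_clique [set a; b; c]%SET ->
  exists r s t : nat,
    let T := [:: (r.+1, s, t); (r, s.+1, t); (r, s, t.+1)] in
    [/\ (r + s + t).+1 = N,
        [/\ loc_val a \in T, loc_val b \in T & loc_val c \in T],
        [/\ a != b, a != c & b != c] &
        [set a; b; c]%SET = [set l : location N | loc_val l \in T]%SET].
Proof.
move=> [r [s [t [hN E]]]]; exists r, s, t; split => //.
  have mem l : l \in [set a; b; c]%SET ->
      loc_val l \in [:: (r.+1, s, t); (r, s.+1, t); (r, s, t.+1)].
    by rewrite E inE.
  by split; apply: mem; rewrite !inE eqxx ?orbT.
have h1 : (r.+1 + s + t)%N == N by lia.
have h2 : (r + s.+1 + t)%N == N by lia.
have h3 : (r + s + t.+1)%N == N by lia.
pose x1 := @Location N (r.+1, s, t) h1.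
pose x2 := @Location N (r, s.+1, t) h2.
pose x3 := @Location N (r, s, t.+1) h3.
have Ex : [set a; b; c]%SET = [set x1; x2; x3]%SET.
  by rewrite E; apply/setP => l; rewrite !inE -!val_eqE /= orbA.
have c3 : #|[set x1; x2; x3]%SET| = 3.
  rewrite -finset.setUA cardsU1 cards2 !inE -!val_eqE /= !xpair_eqE.
  by rewrite -[r.+1 == r]/(r.+1 == r)%N -[s.+1 == s]/(s.+1 == s)%N; lia.
move: c3; rewrite -Ex => c3.
split; apply/eqP => e; move: c3; rewrite e.
- by rewrite finset.setUid cards2; lia.
- by rewrite finset.setUC finset.setUA finset.setUid cards2; lia.
- by rewrite -finset.setUA finset.setUid cards2; lia.
Qed.

Lemma black_clique_perm N (a b c : location N) r s t :
  (r + s + t).+1 = N ->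
  (forall x, x \in [:: loc_val a; loc_val b; loc_val c] =
             (x \in [:: (r.+1, s, t); (r, s.+1, t); (r, s, t.+1)])) ->
  is_black_clique [set a; b; c]%SET.
Proof.
move=> hN E; exists r, s, t; split=> //; apply/setP => l.
by rewrite !inE -!val_eqE /= -orbA; have := E (loc_val l); rewrite !inE.
Qed.

Lemma black_clique_line N (a b c : location N) :
  is_black_clique [set a; b; c]%SET ->
  exists2 L, is_line L & [/\ a \in L, b \in L & a != b].
Proof.
move=> /black_clique_coords [r [s [t [hN [ha hb _] [nab _ _] _]]]].
suff [eta e] : exists eta : 'I_3, coord eta a = coord eta b.
  exists [set l | coord eta l == coord eta a]%SET; last by rewrite !inE e eqxx.
  exists eta, (coord eta a); split => //.
  have := locP a; rewrite /coord.
  by case: (eta) => [[|[|[]]]] //= _; case: (a) => [[[? ?] ?]] /=; lia.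
move: ha hb nab; rewrite -val_eqE /coord /= !inE => /or3P[]/eqP-> /or3P[]/eqP->;
  rewrite ?eqxx // => _; solve [by exists (@Ordinal 3 0 isT)
   | by exists (@Ordinal 3 1 isT) | by exists (@Ordinal 3 2 isT)].
Qed.

Lemma third_eq N (la mu nu : location N) :
  is_black_clique [set la; mu; nu]%SET -> third la mu = nu.
Proof.
move=> h; apply: xget_unique => // nu' h'.
have [r [s [t [hN [ha hb hc] [nab nac nbc] E]]]] := black_clique_coords h.
have [r' [s' [t' [hN' [ha' hb' hc'] [_ nac' nbc'] E']]]] :=
  black_clique_coords h'.
suff [er es et] : [/\ r = r', s = s' & t = t'].
  subst r' s' t'; rewrite -E in E'.
  have : nu' \in [set la; mu; nu]%SET by rewrite -E' !inE eqxx orbT.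
  by rewrite !inE (eq_sym nu' la) (eq_sym nu' mu) (negPf nac') (negPf nbc')
    => /eqP.
move: nab ha hb ha' hb'; rewrite -val_eqE /= !inE => nab ha hb.
case/or3P: ha nab => /eqP->; case/or3P: hb => /eqP->; rewrite ?eqxx // => _;
  move=> /or3P[]/eqP[] ? ? ? /or3P[]/eqP[] ? ? ?; split; lia.
Qed.

Section Sanity.
Variables (F : fieldType) (N : nat) (B : billiard_array F N).

Lemma ba_line2 L (a b : location N) x y : is_line L -> a \in L -> b \in L ->
  a != b -> x \in B a -> y \in B b -> x + y = 0 -> x = 0 /\ y = 0.
Proof.
move=> /(@ba_line F N B) /directv_sum_independent dx aL bL nab xa yb e.
pose us l := if l == a then x else if l == b then y else 0.
have us0 : \sum_(l in L) us l = 0.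
  rewrite (bigD1 a) //= (bigD1 b) ?bL ?(eq_sym b) //= big1.
    by rewrite /us !eqxx eq_sym (negPf nab) addr0.
  by move=> l /andP[/andP[_ /negPf la] /negPf lb]; rewrite /us la lb.
have usB l : l \in L -> us l \in B l.
  by move=> _; rewrite /us; case: eqP => [->//|_]; case: eqP => [->//|_];
    exact: mem0v.
have h l : l \in L -> us l = 0 := dx us usB us0 l.
by have := (h _ aL, h _ bL); rewrite /us !eqxx eq_sym (negPf nab) => -[].
Qed.

Lemma ba_clique2 (a b c : location N) x y : is_black_clique [set a; b; c]%SET ->
  x \in B a -> y \in B b -> x + y = 0 -> x = 0 /\ y = 0.
Proof.
by move=> /black_clique_line[L lL [aL bL nab]]; apply: ba_line2 lL aL bL nab.
Qed.

Lemma btilde_unique (la mu nu : location N) u :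
  is_black_clique [set la; mu; nu]%SET -> u \in B la -> u != 0 ->
  exists! v, [/\ v \in B mu, v != 0 & u + v \in B nu].
Proof.
move=> h ula u0.
have h2 : is_black_clique [set la; nu; mu]%SET by rewrite finset.setUAC.
have h3 : is_black_clique [set mu; nu; la]%SET.
  by rewrite finset.setUC finset.setUA.
have [_ [_ [_ [_ _ [nab nac nbc] _]]]] := black_clique_coords h.
have sumE (V : nmodType) (G : location N -> V) :
    \sum_(l in [set la; mu; nu]%SET) G l = G la + G mu + G nu.
  rewrite -finset.setUA big_setU1 ?inE ?negb_or ?nab //= big_setU1 ?inE //=.
  by rewrite big_set1 addrA.
have [x [xla x0 [y [z [ymu znu e]]]]] : exists x, [/\ x \in B la, x != 0 &
    exists y z, [/\ y \in B mu, z \in B nu & x + y + z = 0]].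
  apply: contrapT => no; case/negP: (@ba_black F N B _ h).
  apply/directv_sum_independent => us usB; rewrite sumE => e l.
  have [a b c] : [/\ us la \in B la, us mu \in B mu & us nu \in B nu].
    by split; apply: usB; rewrite !inE eqxx ?orbT.
  have x0 : us la = 0.
    apply: contrapT => /eqP x0; apply: no; exists (us la); split => //.
    by exists (us mu), (us nu).
  rewrite x0 add0r in e; have [? ?] := ba_clique2 h3 b c e.
  by rewrite !inE => /orP[/orP[]|] /eqP->.
have [k uE] : exists k, u = k *: x.
  have : (<[x]> == B la)%VS.
    by rewrite eqEdim -memvE xla (@ba_dim1 F N B) dim_vline x0.
  by move/eqP=> E; apply/vlineP; rewrite E.
have k0 : k != 0 by apply: contraNneq u0 => k0; rewrite uE k0 scale0r.
have uky : u + k *: y \in B nu.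
  have -> : u + k *: y = - (k *: z).
    by apply/eqP; rewrite -subr_eq0 opprK uE -!scalerDr e scaler0.
  by rewrite memvN memvZ.
exists (k *: y); split; first split => //.
- exact: memvZ.
- rewrite scaler_eq0 (negPf k0) /=; apply: contraNneq x0 => y0.
  by move: e; rewrite y0 addr0 => /(ba_clique2 h2 xla znu)[-> _].
move=> v [vmu _ uv].
have yv : v - k *: y \in B mu by rewrite memvB // memvZ.
have e2 : (v - k *: y) + ((u + k *: y) - (u + v)) = 0.
  by rewrite opprD [u + _ + _]addrACA subrr add0r addrA subrK subrr.
have [/eqP + _] := ba_clique2 h3 yv (memvB uky uv) e2.
by rewrite subr_eq0 => /eqP.
Qed.

Lemma btilde0 (la mu nu : location N) :
  is_black_clique [set la; mu; nu]%SET -> btilde B la mu 0 = 0.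
Proof.
move=> h; apply: xgetPN => v [vmu v0]; rewrite add0r (third_eq h) => vnu.
have h3 : is_black_clique [set mu; nu; la]%SET.
  by rewrite finset.setUC finset.setUA.
have [e _] := ba_clique2 h3 vmu (etrans (memvN _ _) vnu) (subrr v).
by rewrite e eqxx in v0.
Qed.

Lemma btildeP (la mu nu : location N) u :
  is_black_clique [set la; mu; nu]%SET -> u \in B la -> u != 0 ->
  [/\ btilde B la mu u \in B mu, btilde B la mu u != 0 &
      u + btilde B la mu u \in B nu].
Proof.
move=> h ula u0; have [v [hv _]] := btilde_unique h ula u0.
pose P w := [/\ w \in B mu, w != 0 & u + w \in B (third la mu)].
have Pv : P v by rewrite /P (third_eq h).
by have : P (btilde B la mu u) := xgetI 0 Pv; rewrite /P (third_eq h).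
Qed.

Lemma btildeZ (la mu nu : location N) k u :
  is_black_clique [set la; mu; nu]%SET -> u \in B la ->
  btilde B la mu (k *: u) = k *: btilde B la mu u.
Proof.
move=> h ula; have [->|u0] := eqVneq u 0.
  by rewrite scaler0 (btilde0 h) scaler0.
have [->|k0] := eqVneq k 0; first by rewrite !scale0r (btilde0 h).
have [v1 v2 v3] := btildeP h ula u0.
have ku : k *: u != 0 by rewrite scaler_eq0 negb_or k0.
have kula : k *: u \in B la by rewrite memvZ.
have [w [_ wU]] := btilde_unique h kula ku.
rewrite -(wU _ (btildeP h kula ku)); apply: wU; split; first exact: memvZ.
  by rewrite scaler_eq0 negb_or k0.
by rewrite -scalerDr memvZ.
Qed.

Lemma bhatP (hN : (2 <= N)%N) (p : location (N - 2)) :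
  let la := white1 hN p in let mu := white2 hN p in let nu := white3 hN p in
  forall u, u \in B la ->
  btilde B nu la (btilde B mu nu (btilde B la mu u)) = val (bhat hN B p) *: u.
Proof.
move=> la mu nu.
have hp := eqP (locP p).
have q1 : (p.1.1 + p.1.2 + p.2.+2)%N == N by lia.
have q2 : (p.1.1.+2 + p.1.2 + p.2)%N == N by lia.
have q3 : (p.1.1 + p.1.2.+2 + p.2)%N == N by lia.
pose c1 := @Location N (p.1.1, p.1.2, p.2.+2) q1.
pose c2 := @Location N (p.1.1.+2, p.1.2, p.2) q2.
pose c3 := @Location N (p.1.1, p.1.2.+2, p.2) q3.
have k1 : is_black_clique [set la; mu; c1]%SET.
  apply: (@black_clique_perm _ _ _ _ p.1.1 p.1.2 p.2.+1); first lia.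
  by move=> x; rewrite !inE; do ![case: eqP => // _].
have k2 : is_black_clique [set mu; nu; c2]%SET.
  apply: (@black_clique_perm _ _ _ _ p.1.1.+1 p.1.2 p.2); first lia.
  by move=> x; rewrite !inE; do ![case: eqP => // _].
have k3 : is_black_clique [set nu; la; c3]%SET.
  apply: (@black_clique_perm _ _ _ _ p.1.1 p.1.2.+1 p.2); first lia.
  by move=> x; rewrite !inE; do ![case: eqP => // _].
rewrite /bhat; apply: (xgetPex _ (P := fun c : {c : F | c != 0} =>
  forall u, u \in B la -> _ = val c *: u)).
pose f u := btilde B nu la (btilde B mu nu (btilde B la mu u)).
pose x := vpick (B la).
have x0 : x != 0 by rewrite vpick0 -dimv_eq0 (@ba_dim1 F N B).
have xla : x \in B la := memv_pick _.
have [a1 a2 _] := btildeP k1 xla x0.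
have [b1 b2 _] := btildeP k2 a1 a2.
have [d1 d2 _] := btildeP k3 b1 b2.
have laE : (<[x]> = B la)%VS.
  by apply/eqP; rewrite eqEdim -memvE xla (@ba_dim1 F N B) dim_vline x0.
have [c cE] : exists c, f x = c *: x by apply/vlineP; rewrite laE.
have c0 : c != 0 by apply: contraNneq d2 => c0; rewrite -/(f x) cE c0 scale0r.
exists (exist _ c c0) => u; rewrite -laE => /vlineP[k ->] /=.
rewrite (btildeZ _ k1) // (btildeZ _ k2) // (btildeZ _ k3) // -/(f x) cE.
by rewrite !scalerA mulrC.
Qed.

End Sanity.

(* Main.v *)
Require Import Defs.
From mathcomp Require Import all_boot all_algebra.
From mathcomp Require Import zify boolp.


(** A Billiard Array can be rigidified by choosing vectors.  Index the location
    [(r, s, t)] by the pair [(r, t)], since [s = N - r - t].  Each black clique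
    consists of [(r, t)], [(r+1, t)] and [(r, t+1)], and forces a linear
    relation between its three lines.  Rescaling the spanning vectors [U r t]
    one row [t] after the other, this relation takes the form
      [U r (t+1) = U r t + c r t *: U (r+1) t],
    and rescaling inside row 0 makes [c r 0 = 1].  Such a family is called a
    frame below.  A single global scalar remains free, so the numbers [c r t]
    with [t > 0] are invariants, indexed by the locations of diameter [N - 2].

    Following a white clique around in these coordinates, the three maps
    multiply by [c r (t+1)], by [-1] and by [- (c r t)^-1], so that the value
    function is [c r (t+1) / c r t] ([frame_bhat]).  With [c r 0 = 1], the value
    function [v] and the coefficients [c = frame_coef v] therefore determine one
    another.

    Injectivity: every array has a frame with coefficients
    [frame_coef (bhat B)] ([frame_exists]).  Row 0 of a frame is a basis and the
    recurrence produces all other rows from it, so arrays having frames with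
    the same coefficients are isomorphic ([frame_iso]).  Conversely an
    isomorphism carries frames to frames ([frame_image]).

    Surjectivity: for arbitrary nonzero [c], start from the standard basis of
    the row vectors and define [U] by the recurrence ([model]).  Then [U r t]
    is supported on the coordinates from [r] to [r + t], and its two extreme
    coordinates do not vanish.  Along a line of locations the first or the last
    coordinates of the supports are distinct, so the vectors are in echelon form
    and the sum of their spans is direct. *)

Set Implicit Arguments.
Unset Strict Implicit.
Unset Printing Implicit Defensive.

Import GRing.Theory.
Local Open Scope ring_scope.

(** * Locations indexed by their first and last coordinates *)

Section Indexing.
Variable n : nat.

Fact corner_subproof : ((n, 0, 0).1.1 + (n, 0, 0).1.2 + (n, 0, 0).2)%N == n.
Proof. by rewrite /= !addn0. Qed.

(** Totality in [r] and [t] lets vectors and coefficients be indexed by natural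
    numbers, without carrying the bound [r + t <= n] in the types. *)
Definition loc_at (r t : nat) : location n :=
  insubd (Location corner_subproof) (r, n - r - t, t)%N.

Lemma loc_atE r t : (r + t <= n)%N ->
  loc_val (loc_at r t) = (r, n - r - t, t)%N.
Proof.
by move=> h; apply: (insubdK (Location corner_subproof)); rewrite unfold_in /=; lia.
Qed.

Lemma loc_at_coords (l : location n) : l = loc_at l.1.1 l.2.
Proof.
case: l => [[[r s] t] /= h]; apply: val_inj; rewrite /= loc_atE; last by lia.
by congr (_, _, _); lia.
Qed.

Lemma loc_bound (l : location n) : (l.1.1 + l.2 <= n)%N.
Proof. by have := eqP (locP l); lia. Qed.

Lemma loc_at_clique r t : (r + t < n)%N ->
  is_black_clique [set loc_at r t; loc_at r.+1 t; loc_at r t.+1]%SET.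
Proof.
move=> h; apply: (@black_clique_perm _ _ _ _ r (n - r - t).-1 t); first lia.
move=> x; rewrite !loc_atE; try lia.
have -> : (n - r - t = (n - r - t).-1.+1)%N by lia.
have -> : (n - r.+1 - t = (n - r - t).-1)%N by lia.
have -> : (n - r - t.+1 = (n - r - t).-1)%N by lia.
by rewrite !inE orbCA.
Qed.

Lemma black_clique_loc_at (C : {set location n}) : is_black_clique C ->
  exists r t : nat, (r + t < n)%N /\
    C = [set loc_at r t; loc_at r.+1 t; loc_at r t.+1]%SET.
Proof.
move=> [r [s [t [hn ->]]]]; exists r, t; split; first lia.
apply/setP => l; rewrite !inE -!val_eqE /= !loc_atE; try lia.
have -> : (n - r - t = s.+1)%N by lia.
have -> : (n - r.+1 - t = s)%N by lia.
have -> : (n - r - t.+1 = s)%N by lia.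
by rewrite -orbA orbCA.
Qed.

End Indexing.

Lemma black_clique_rot N (a b d : location N) :
  is_black_clique [set a; b; d]%SET -> is_black_clique [set b; d; a]%SET.
Proof. by rewrite finset.setUC finset.setUA finset.setUC finset.setUA. Qed.

(** * Frames of a Billiard Array *)

Section Frames.
Variables (F : fieldType) (N : nat).
Implicit Types (B : billiard_array F N) (c : nat -> nat -> F).

(** The normalization [c r 0 = 1] is left out: [frame_bhat] is used for
    coefficients on which it has not yet been established, and [frame_coef]
    satisfies it by construction. *)
Definition frame B c (U : nat -> nat -> ba_space B) : Prop :=
  (forall r t, (r + t <= N)%N -> U r t \in B (loc_at N r t) /\ U r t != 0) /\
  (forall r t, (r + t < N)%N -> U r t.+1 = U r t + c r t *: U r.+1 t).
Arguments frame B c U : clear implicits.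

Lemma ba_vline B l (x : ba_space B) : x \in B l -> x != 0 -> B l = <[x]>%VS.
Proof.
move=> xl x0; apply/esym/eqP.
by rewrite eqEdim -memvE xl (@ba_dim1 F N B) dim_vline x0.
Qed.

Lemma btilde_eq B (la mu nu : location N) u v :
  is_black_clique [set la; mu; nu]%SET -> u \in B la -> u != 0 ->
  v \in B mu -> v != 0 -> u + v \in B nu -> btilde B la mu u = v.
Proof.
move=> h ula u0 vmu v0 uv; have [w [_ wU]] := btilde_unique h ula u0.
by rewrite -(wU _ (btildeP h ula u0)) -(wU v).
Qed.

(** For the white clique at [(r, t)], with corners [la = (r, t+1)],
    [mu = (r+1, t+1)] and [nu = (r+1, t)], the recurrence read on the three
    adjacent black cliques gives
      [U la |-> c r (t+1) *: U mu], [U mu |-> - U nu],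
      [c r t *: U nu |-> - U la].
    To avoid inverses, the composite is evaluated at [c r t *: U la]. *)
Lemma frame_bhat (hN : (2 <= N)%N) B c U : frame B c U ->
  (forall r t, (r + t < N)%N -> c r t != 0) ->
  forall r t, (r + t + 2 <= N)%N ->
  c r t.+1 = val (bhat hN B (loc_at (N - 2) r t)) * c r t.
Proof.
move=> [UB Urec] c0 r t h.
set p := loc_at (N - 2) r t.
have pE : loc_val p = (r, N - 2 - r - t, t)%N by rewrite loc_atE //; lia.
have E1 : white1 hN p = loc_at N r t.+1.
  by apply: val_inj; rewrite /= loc_atE ?pE /=; [congr (_, _, _); lia | lia].
have E2 : white2 hN p = loc_at N r.+1 t.+1.
  by apply: val_inj; rewrite /= loc_atE ?pE /=; [congr (_, _, _); lia | lia].
have E3 : white3 hN p = loc_at N r.+1 t.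
  by apply: val_inj; rewrite /= loc_atE ?pE /=; [congr (_, _, _); lia | lia].
have [|Ula Ula0] := UB r t.+1; first lia.
have [|Umu Umu0] := UB r.+1 t.+1; first lia.
have [|Unu Unu0] := UB r.+1 t; first lia.
have cla0 : c r t.+1 != 0 by apply: c0; lia.
have crt0 : c r t != 0 by apply: c0; lia.
(* The black cliques on the sides la-mu, mu-nu and nu-la of the white one. *)
have k1 := @loc_at_clique N r t.+1 ltac:(lia).
have k2 := black_clique_rot (black_clique_rot (@loc_at_clique N r.+1 t ltac:(lia))).
have k3 := black_clique_rot (@loc_at_clique N r t ltac:(lia)).
have step1 : btilde B (loc_at N r t.+1) (loc_at N r.+1 t.+1) (U r t.+1) =
    c r t.+1 *: U r.+1 t.+1.
  apply: (btilde_eq k1) => //; [exact: memvZ | by rewrite scaler_eq0 negb_or cla0 |].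
  by rewrite -Urec; [apply: (UB _ _ _).1; lia | lia].
have step2 : btilde B (loc_at N r.+1 t.+1) (loc_at N r.+1 t) (U r.+1 t.+1) =
    - U r.+1 t.
  apply: (btilde_eq k2) => //; rewrite ?memvN ?oppr_eq0 //.
  rewrite Urec; last by lia.
  by rewrite addrC addKr memvZ //; apply: (UB _ _ _).1; lia.
have step3 : btilde B (loc_at N r.+1 t) (loc_at N r t.+1) (c r t *: U r.+1 t) =
    - U r t.+1.
  apply: (btilde_eq k3); rewrite ?memvN ?oppr_eq0 ?memvZ ?scaler_eq0 ?negb_or ?crt0 //.
  rewrite Urec; last by lia.
  by rewrite opprD addrC addrNK memvN; apply: (UB _ _ _).1; lia.
have := @bhatP F N B hN p (c r t *: U r t.+1).
rewrite E1 E2 E3 => /(_ (memvZ _ Ula)).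
rewrite (btildeZ _ k1) // step1 [c r t *: (c r t.+1 *: _)]scalerA (btildeZ _ k2) // step2 scalerN -scaleNr.
have -> : - (c r t * c r t.+1) *: U r.+1 t = - c r t.+1 *: (c r t *: U r.+1 t).
  by rewrite scalerA mulNr mulrC.
rewrite (btildeZ _ k3) ?memvZ // step3 scalerN scaleNr opprK scalerA.
by move/eqP; rewrite -subr_eq0 -scalerBl scaler_eq0 (negPf Ula0) orbF subr_eq0 => /eqP.
Qed.

(** The solution of [c r (t+1) = v r t * c r t] with [c r 0 = 1]. *)
Definition frame_coef (v : value_function F (N - 2)) (r t : nat) : F :=
  \prod_(i < t) val (v (loc_at (N - 2) r i)).

Lemma frame_coef_neq0 v r t : frame_coef v r t != 0.
Proof. by apply/prodf_neq0 => i _; case: (v _). Qed.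

Lemma frame_coefS v r t :
  frame_coef v r t.+1 = val (v (loc_at (N - 2) r t)) * frame_coef v r t.
Proof. by rewrite /frame_coef big_ord_recr mulrC. Qed.

Lemma frame_coef_bhat (hN : (2 <= N)%N) B v U :
  frame B (frame_coef v) U -> bhat hN B = v.
Proof.
move=> frU; apply/funext => p; apply: val_inj.
have [r [t [rt ->]]] : exists r t, (r + t <= N - 2)%N /\ p = loc_at _ r t.
  by exists p.1.1, p.2; split; [apply: loc_bound | apply: loc_at_coords].
apply: (mulIf (frame_coef_neq0 v r t)).
rewrite -frame_coefS (frame_bhat hN frU) //; last lia.
by move=> *; apply: frame_coef_neq0.
Qed.

Fixpoint bottom_frame B (r : nat) : ba_space B :=
  if r is r'.+1 then btilde B (loc_at N r' 0) (loc_at N r 0) (bottom_frame B r')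
  else vpick (B (loc_at N 0 0)).

(** If [x] spans the line at [(r, t)], the vector [y] of the line at [(r+1, t)]
    with [x + y] in the line at [(r, t+1)] is the image of [x] under [btilde]:
    taking [x + y] at [(r, t+1)] gives the recurrence with some coefficients.
    Choosing row 0 itself along [btilde] makes the coefficients of that row
    equal to 1. *)
Fixpoint std_frame B (r t : nat) : ba_space B :=
  if t is t'.+1 then
    std_frame B r t' +
      btilde B (loc_at N r t') (loc_at N r.+1 t') (std_frame B r t')
  else bottom_frame B r.

Lemma std_frameP B r t : (r + t <= N)%N ->
  std_frame B r t \in B (loc_at N r t) /\ std_frame B r t != 0.
Proof.
elim: t r => [|t IHt] r h /=.
  elim: r h => [|r IHr] h /=.
    by split; [apply: memv_pick | rewrite vpick0 -dimv_eq0 (@ba_dim1 F N B)].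
  have [|xB x0] := IHr; first lia.
  by case: (btildeP (@loc_at_clique N r 0 ltac:(lia)) xB x0).
have [|xB x0] := IHt r; first lia.
have k := @loc_at_clique N r t ltac:(lia).
have [yB y0 xyB] := btildeP k xB x0; split=> //.
by apply: contraNneq x0 => /(ba_clique2 k xB yB)[->].
Qed.

(** One-dimensionality of the lines provides some coefficients [c];
    [frame_bhat] shows that they obey the recurrence defining [frame_coef]. *)
Lemma frame_exists (hN : (2 <= N)%N) B :
  frame B (frame_coef (bhat hN B)) (std_frame B).
Proof.
split=> [|r t rt]; first exact: std_frameP.
have /choice[c cP] : forall rt : nat * nat, exists c : F, (rt.1 + rt.2 < N)%N ->
    c != 0 /\ btilde B (loc_at N rt.1 rt.2) (loc_at N rt.1.+1 rt.2)
      (std_frame B rt.1 rt.2) = c *: std_frame B rt.1.+1 rt.2.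
  move=> [r' t'] /=; have [h|] := ltnP; last by exists 0.
  have [|xB x0] := @std_frameP B r' t'; first lia.
  have [|yB y0] := @std_frameP B r'.+1 t'; first lia.
  have [zB z0 _] := btildeP (@loc_at_clique N r' t' h) xB x0.
  move: zB; rewrite (ba_vline yB y0) => /vlineP[k kE]; exists k => _.
  by split=> //; apply: contraNneq z0 => k0; rewrite kE k0 scale0r.
pose c' r t := c (r, t).
have c'0 r' t' : (r' + t' < N)%N -> c' r' t' != 0 by move=> /(cP (r', t'))[].
have frc : frame B c' (std_frame B).
  split=> [|r' t' h] /=; first exact: std_frameP.
  by case: (cP (r', t') h) => _ /= ->.
suff <- : c' r t = frame_coef (bhat hN B) r t by apply: frc.2.
elim: t rt => [|t IHt] rt.
  rewrite /frame_coef big_ord0.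
  have [|yB y0] := @std_frameP B r.+1 0; first lia.
  have [_ /= /eqP] := cP (r, 0%N) rt.
  rewrite -[X in X == _]scale1r -subr_eq0 -scalerBl scaler_eq0 (negPf y0) orbF.
  by rewrite subr_eq0 => /eqP.
by rewrite frame_coefS -IHt ?(frame_bhat hN frc) //; lia.
Qed.

Lemma frame_image B B' c U (f : 'Hom(ba_space B, ba_space B')) :
  injective f -> (forall l, (f @: B l)%VS = B' l) -> frame B c U ->
  frame B' c (fun r t => f (U r t)).
Proof.
move=> fI fB [UB Urec]; split=> r t h; last by rewrite Urec // linearD linearZ.
have [xB x0] := UB r t h; rewrite -fB memv_img //; split=> //.
by apply: contraNneq x0 => fx; apply/eqP/fI; rewrite fx linear0.
Qed.

(** Row 0 of the frame spans the line of locations [t = 0], whose [N + 1]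
    subspaces have a direct sum, in a space of dimension [N + 1]. *)
Lemma frame_basis B c U : frame B c U ->
  basis_of {:ba_space B} [tuple U i 0%N | i < N.+1].
Proof.
move=> [UB _]; rewrite basisEfree size_tuple (@ba_dim_space F N B) leqnn subvf !andbT.
apply/freeP => k; under eq_bigr do rewrite (nth_map ord0) ?size_enum_ord // nth_ord_enum.
move=> e i.
have lineL : is_line [set l : location N | l.2 == 0%N]%SET.
  by exists (@Ordinal 3 2 isT), 0%N.
move: (@ba_line F N B _ lineL) => /directv_sum_independent dx.
have atE (j : 'I_N.+1) : loc_val (loc_at N j 0) = (j : nat, N - j, 0)%N.
  by rewrite loc_atE ?subn0 //; have := ltn_ord j; lia.
pose us (l : location N) := k (inord l.1.1) *: U l.1.1 0%N.
have usB l : l \in [set l : location N | l.2 == 0%N]%SET -> us l \in B l.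
  rewrite inE => /eqP l2; apply: memvZ.
  have := loc_bound l; rewrite {4}(loc_at_coords l) l2.
  by move=> h; case: (UB _ _ h).
have us0 : \sum_(l in [set l : location N | l.2 == 0%N]%SET) us l = 0.
  rewrite -[RHS]e (reindex (fun j : 'I_N.+1 => loc_at N j 0)) /=.
    apply: eq_big => j; first by rewrite inE atE.
    by rewrite /us atE /= inord_val.
  exists (fun l : location N => inord l.1.1) => l.
    by rewrite inE => _; rewrite atE /= inord_val.
  rewrite !inE => /eqP l2; rewrite [RHS]loc_at_coords l2 inordK //.
  by have := loc_bound l; lia.
have := dx us usB us0 (loc_at N i 0); rewrite inE /us /= atE /= inord_val.
move=> /(_ (eqxx _))/eqP; rewrite scaler_eq0.
have [|_ /negPf-> ] := UB i 0%N; last by rewrite orbF => /eqP.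
by have := ltn_ord i; lia.
Qed.

(** The linear map matching the two bases given by row 0 commutes with the
    recurrence, so it matches the whole frames. *)
Lemma frame_iso B B' c U U' :
  frame B c U -> frame B' c U' -> isomorphic B B'.
Proof.
move=> frU frU'.
have [bX bX'] := (frame_basis frU, frame_basis frU').
set X := [tuple U i 0%N | i < N.+1] in bX; set X' := [tuple U' i 0%N | i < N.+1] in bX'.
have inverse (V W : vectType F) (Y : N.+1.-tuple V) (Z : N.+1.-tuple W)
    (f : {linear V -> W}) (g : {linear W -> V}) :
    basis_of {:V} Y -> map f Y = Z -> map g Z = Y -> cancel f g.
  move=> bY fY gZ v; rewrite (coord_basis bY (memvf v)) !linear_sum /=.
  apply: eq_bigr => i _; rewrite !linearZ /=.
  rewrite -(nth_map _ 0) ?size_tuple // -(nth_map _ 0) ?size_map ?size_tuple //.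
  by rewrite fY gZ.
have [f /(_ (basis_free bX)) fX] := linear_of_free X X'.
have [g /(_ (basis_free bX')) gX] := linear_of_free X' X.
rewrite !size_tuple in fX gX; move: (fX erefl) (gX erefl) => {}fX {}gX.
have fgK := inverse _ _ _ _ f g bX fX gX.
have gfK := inverse _ _ _ _ g f bX' gX fX.
have sE v : linfun f v = f v by rewrite lfunE.
have sU r t : (r + t <= N)%N -> f (U r t) = U' r t.
  elim: t r => [|t IHt] r h.
    have rN : (r < N.+1)%N by lia.
    have := congr1 (nth 0 ^~ r) fX; rewrite (nth_map 0) ?size_tuple //.
    by rewrite -!(tnth_nth _ _ (Ordinal rN)) !tnth_mktuple.
  by rewrite frU.2 ?frU'.2 ?linearD ?linearZ ?IHt //=; lia.
exists (linfun f); split.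
  by exists (linfun g) => v; rewrite !lfunE /= ?fgK ?gfK.
move=> l; rewrite (loc_at_coords l); have h := loc_bound l.
have [xB x0] := frU.1 _ _ h; have [yB y0] := frU'.1 _ _ h.
by rewrite (ba_vline xB x0) (ba_vline yB y0) limg_line sE sU.
Qed.

(** The value function is a complete invariant; in particular it makes sense on
    isomorphism classes, and isomorphism is an equivalence relation. *)
Lemma isomorphic_bhat (hN : (2 <= N)%N) B B' :
  isomorphic B B' <-> bhat hN B = bhat hN B'.
Proof.
split=> [[f [fbij fB]] | e].
  have frB := frame_image (bij_inj fbij) fB (frame_exists hN B).
  by rewrite (frame_coef_bhat hN frB).
by apply: frame_iso (frame_exists hN B) _; rewrite e; apply: frame_exists.
Qed.

End Frames.
Arguments frame {F N} B c U.

(** * The array with prescribed coefficients *)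

(** Echelon form: in a vanishing combination with some nonzero coefficient, take
    such an index [i] of least rank; at the coordinate [p i] only the term of
    [i] survives. *)
Lemma directv_triangular (F : fieldType) (n : nat) (I : finType) (P : {set I})
    (u : I -> 'rV[F]_n) (rk : I -> nat) (p : I -> 'I_n) :
  (forall i, i \in P -> u i 0 (p i) != 0) ->
  (forall i j, i \in P -> j \in P -> j != i -> (rk i <= rk j)%N ->
     u j 0 (p i) = 0) ->
  directv (\sum_(i in P) <[u i]>).
Proof.
move=> piv tri; apply/directv_sum_independent => us usB us0.
have /choice[k kE] : forall i, exists k, i \in P -> us i = k *: u i.
  move=> i; have [iP|] := boolP (i \in P); last by exists 0.
  by have /vlineP[k ->] := usB i iP; exists k.
suff k0 i : i \in P -> k i = 0 by move=> i iP; rewrite kE // k0 ?scale0r.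
move=> iP; apply: contrapT => /eqP ki0.
have Qi : (i \in P) && (k i != 0) by rewrite iP.
case: (@arg_minnP _ i (fun j => (j \in P) && (k j != 0)) rk Qi) => j /andP[jP kj0] jmin.
have := congr1 (fun v : 'rV_n => v 0 (p j)) us0.
rewrite /= summxE mxE (bigD1 j) //= big1 => [|m /andP[mP mj]].
  rewrite addr0 kE // mxE => /eqP.
  by rewrite mulf_eq0 (negPf kj0) (negPf (piv j jP)).
rewrite kE // mxE; have [->|km0] := eqVneq (k m) 0; first by rewrite mul0r.
by rewrite tri ?mulr0 //; apply: jmin; rewrite mP.
Qed.

Section Construction.
Variables (F : fieldType) (N : nat) (c : nat -> nat -> F).
Hypothesis c_neq0 : forall r t, c r t != 0.

(** Coordinate [i] of the vector at [(r, t)] of the frame whose row 0 is the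
    standard basis. *)
Fixpoint model_coef (r t i : nat) : F :=
  if t is t'.+1 then model_coef r t' i + c r t' * model_coef r.+1 t' i
  else (i == r)%:R.

Lemma model_coef_out r t i : ~~ (r <= i <= r + t)%N -> model_coef r t i = 0.
Proof.
elim: t r => [|t IHt] r h /=; first by case: eqP h => //; lia.
by rewrite !IHt ?mulr0 ?addr0 //; lia.
Qed.

Lemma model_coef_bottom r t : model_coef r t r = 1.
Proof.
elim: t => [|t IHt] /=; first by rewrite eqxx.
by rewrite IHt model_coef_out ?mulr0 ?addr0 //; lia.
Qed.

Lemma model_coef_top r t : model_coef r t (r + t)%N != 0.
Proof.
elim: t r => [|t IHt] r /=; first by rewrite addn0 eqxx oner_neq0.
rewrite model_coef_out ?add0r; last by lia.
by rewrite addnS -addSn mulf_neq0.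
Qed.

Definition model_vec (r t : nat) : 'rV[F]_N.+1 := \row_i model_coef r t i.

Lemma model_vecS r t : model_vec r t.+1 = model_vec r t + c r t *: model_vec r.+1 t.
Proof. by apply/rowP => i; rewrite !mxE. Qed.

Lemma model_vec_neq0 r t : (r + t <= N)%N -> model_vec r t != 0.
Proof.
move=> h; apply/eqP => /rowP/(_ (inord r)); rewrite !mxE inordK; last by lia.
by rewrite model_coef_bottom => /eqP; rewrite oner_eq0.
Qed.

Definition model_fun (l : location N) : {vspace 'rV[F]_N.+1} :=
  <[model_vec l.1.1 l.2]>%VS.

Lemma model_dim1 l : \dim (model_fun l) = 1%N.
Proof. by rewrite dim_vline model_vec_neq0 // loc_bound. Qed.

(** On a line where [r] is constant the last coordinates [r + t] of the supports
    are distinct, and they decrease as [s] grows.  On the other lines [r] varies,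
    and so do the first coordinates. *)
Lemma model_line (L : {set location N}) : is_line L ->
  directv (\sum_(l in L) model_fun l).
Proof.
move=> [eta [m [_ ->]]].
have inj (l l' : location N) : l.1.1 = l'.1.1 -> l.2 = l'.2 -> l = l'.
  by move=> e1 e2; rewrite (loc_at_coords l) e1 e2 -loc_at_coords.
have sumE (l : location N) := eqP (locP l).
have [e0|e0] := eqVneq (val eta) 0%N.
  apply: (@directv_triangular _ _ _ _ (fun l : location N => model_vec l.1.1 l.2)
      (fun l => l.1.2)
      (fun l => inord (l.1.1 + l.2))) => l.
    by rewrite mxE inordK ?model_coef_top // ltnS loc_bound.
  move=> l'; rewrite !inE /Defs.coord e0 /= => /eqP lm /eqP l'm ll' h.
  rewrite mxE inordK ?ltnS ?loc_bound // model_coef_out //.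
  have : l'.2 <> l.2 by move=> e; case/eqP: ll'; apply: inj; rewrite ?l'm.
  by have := sumE l; have := sumE l'; lia.
apply: (@directv_triangular _ _ _ _ (fun l : location N => model_vec l.1.1 l.2)
      (fun l => l.1.1)
      (fun l => inord l.1.1)) => l.
  by rewrite mxE inordK ?model_coef_bottom ?oner_neq0 //; have := sumE l; lia.
move=> l'; rewrite !inE /Defs.coord => lm l'm ll' h.
rewrite mxE inordK; last by have := sumE l; lia.
rewrite model_coef_out //.
suff : l'.1.1 <> l.1.1 by lia.
move=> e; case/eqP: ll'; apply: inj => //; have := sumE l; have := sumE l'.
by move: e0 lm l'm; case: (eta) => [[|[|[]]]] //= _ _ /eqP ? /eqP ?; lia.
Qed.

(** The recurrence is itself a dependency among the three spanning vectors. *)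
Lemma model_black (C : {set location N}) : is_black_clique C ->
  ~~ directv (\sum_(l in C) model_fun l).
Proof.
move=> /black_clique_loc_at[r [t [h ->]]].
have k := loc_at_clique h.
have [_ [_ [_ [_ _ [nbd nba nda] _]]]] := black_clique_coords k.
set b := loc_at N r t in k nbd nba *; set d := loc_at N r.+1 t in k nbd nda *.
set a := loc_at N r t.+1 in k nba nda *.
apply/negP => /directv_sum_independent dx.
pose us l := if l == b then model_vec r t else
  if l == d then c r t *: model_vec r.+1 t else - model_vec r t.+1.
have ub : us b = model_vec r t by rewrite /us eqxx.
have ud : us d = c r t *: model_vec r.+1 t by rewrite /us eqxx eq_sym (negPf nbd).
have ua : us a = - model_vec r t.+1.
  by rewrite /us !(eq_sym a) (negPf nba) (negPf nda).
have usB l : l \in [set b; d; a]%SET -> us l \in model_fun l.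
  rewrite !inE => /orP[/orP[]|] /eqP->; rewrite ?ub ?ud ?ua /model_fun loc_atE /=;
    by rewrite ?memvN ?memvZ ?memv_line //; lia.
have us0 : \sum_(l in [set b; d; a]%SET) us l = 0.
  rewrite -finset.setUA big_setU1 ?inE ?negb_or ?nbd //= big_setU1 ?inE //=.
  by rewrite big_set1 ub ud ua model_vecS addrA subrr.
have := dx us usB us0 b; rewrite !inE eqxx ub => /(_ isT)/eqP.
by rewrite (negPf (model_vec_neq0 _)) //; lia.
Qed.

Lemma model_dim_space : \dim {: 'rV[F]_N.+1} = N.+1.
Proof. by rewrite dimvf /dim /= mul1n. Qed.

Definition model : billiard_array F N :=
  BilliardArray model_dim_space model_dim1 model_line model_black.

Lemma model_frame : frame model c model_vec.
Proof.
split=> r t h; last exact: model_vecS.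
by rewrite model_vec_neq0 //= /model_fun loc_atE //= memv_line.
Qed.

End Construction.

(** * The bijection *)

Theorem corollary19p2 (F : fieldType) (N : nat) (hN : (2 <= N)%N) :
  exists phi : iso_class F N -> value_function F (N - 2),
    (forall B : billiard_array F N, phi (class_of B) = bhat hN B) /\
    bijective phi.
Proof.
pose phi (C : iso_class F N) := bhat hN (projT1 (cid (proj2_sig C))).
have classE (B B' : billiard_array F N) :
    bhat hN B = bhat hN B' -> isomorphic B = isomorphic B'.
  move=> e; apply/funext => D; apply/propext.
  by rewrite !(isomorphic_bhat hN) e.
have phi_class B : phi (class_of B) = bhat hN B.
  rewrite /phi; case: cid => B' /= e; apply/esym/isomorphic_bhat.
  by rewrite e; apply/isomorphic_bhat.
exists phi; split=> //.
pose psi v : iso_class F N := class_of (model N (frame_coef_neq0 (N := N) v)).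
exists psi => [C | v]; last first.
  by rewrite phi_class; apply: frame_coef_bhat; apply: model_frame.
have [B CB] : exists B, C = class_of B.
  by case: C => C [B CB]; exists B; apply: eq_exist.
rewrite CB phi_class; apply: eq_exist; apply: classE.
by apply: frame_coef_bhat; apply: model_frame.
Qed.
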